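(* Let $\mathbf{x}$ be an $n$-periodic trajectory of a discrete Lagrangian system on an $m$-dimensional manifold with Poincaré map $P:W\to W$. Suppose that $V=\operatorname{Ker}(P-I)$ is isotropic, $\dim V=k$, and that the generalized eigenspace $N=\operatorname{Ker}(P-I)^{2m}$ has dimension $2k$. Suppose that $\mathbf{x}$ is nondegenerate $\mathrm{mod}\ V$, that is, the matrices $G_i$ (for all $i$), $\overline G$ and $A^\perp$ are nondegenerate. Then $$\operatorname{ind} h-\operatorname{ind} h\big|_Z-\operatorname{ind} h^\perp=\operatorname{ind} A-\operatorname{ind} A^\perp .$$
   Context: Summation over repeated Greek indices from $1$ to $k$ is assumed; $\operatorname{ind}$ is the negative index (maximal dimension of a negative definite subspace) of a symmetric bilinear form or matrix. For a discrete Lagrangian $L$ on $M\times M$ and an $n$-periodic trajectory $\mathbf{x}=(x_i)$ (i.e. $x_{i+n}=x_i$ and $\partial_2L(x_{i-1},x_i)+\partial_1L(x_i,x_{i+1})=0$), put $E_i=T_{x_i}M$, $A_i=\partial_{22}L(x_{i-1},x_i)+\partial_{11}L(x_i,x_{i+1}):E_i\to E_i^*$ (symmetric), $B_i=-\partial_1\partial_2L(x_i,x_{i+1}):E_i\to E_{i+1}^*$, assumed nondegenerate. Trajectories of the variational system are sequences $u_i\in E_i$, $i\in\mathbb{Z}$, with $A_iu_i-B_{i-1}u_{i-1}-B_i^*u_{i+1}=0$; $W$ is the space of them (identified with pairs $(u_0,u_1)$), $P:(u_0,u_1)\mapsto(u_n,u_{n+1})$, and $\omega(\mathbf{u},\mathbf{v})=\langle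 B_ju_j,v_{j+1}\rangle-\langle B_jv_j,u_{j+1}\rangle$ (independent of $j$) is the $P$-invariant symplectic form. $X=E_1\times\dots\times E_n$ is identified with $n$-periodic sequences, and $h(\mathbf{u},\mathbf{v})=\sum_{i=1}^n\langle A_iu_i-B_{i-1}u_{i-1}-B_i^*u_{i+1},v_i\rangle$ is the Hessian of the action on $X$. Let $w^1,\dots,w^k$ be a basis of $V$, $\mathbf{w}^\alpha=(w_i^\alpha)$ the corresponding $n$-periodic trajectories, $G_i=(g_i^{\alpha\beta})$, $g_i^{\alpha\beta}=\langle B_iw_i^\alpha,w_{i+1}^\beta\rangle$ (symmetric), $(g_{\alpha\beta i})=G_i^{-1}$, $\overline G=\sum_{i=1}^nG_i^{-1}=(\bar g_{\alpha\beta})$, $(\kappa^{\alpha\beta})=\overline G^{-1}$. $Z=\{\mathbf{v}\in X:v_i\in\operatorname{span}(w_i^1,\dots,w_i^k)\text{ for all }i\}$. Let $E_i^\perp=\{u\in E_i:\langle B_{i-1}w_{i-1}^\alpha,u\rangle=0,\ \alpha=1,\dots,k\}$, $X^\perp=E_1^\perp\times\dots\times E_n^\perp\subset X$, and let $h^\perp$ (action form of the reduced system) be the form on $X^\perp$ $$h^\perp(\mathbf{v},\mathbf{v})=h(\mathbf{v},\mathbf{v})-\sum_{i=1}^ng_{\alpha\beta i}\langle B_iv_i,w_{i+1}^\alpha\rangle\langle B_iv_i,w_{i+1}^\beta\rangle .$$ Under the hypotheses, $N=\operatorname{Ker}(P-I)^2$ is symplectic and $V$ is Lagrangian in $N$.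 Let $q_1,\dots,q_k$ be the basis in a Lagrangian complement of $V$ in $N$ with $\omega(w^\alpha,q_\beta)=\delta^\alpha_\beta$, $\omega(q_\alpha,q_\beta)=0$. Then $Pq_\alpha=q_\alpha+s_{\alpha\beta}w^\beta$ with a symmetric matrix $S=(s_{\alpha\beta})$. The symmetric matrices $A=(a_{\alpha\beta})$, $A^\perp=(a^\perp_{\alpha\beta})$ are $$a_{\alpha\beta}=s_{\alpha\delta}\kappa^{\delta\varepsilon}s_{\varepsilon\beta}-s_{\alpha\beta},\qquad a^\perp_{\alpha\beta}=s_{\alpha\beta}-\bar g_{\alpha\beta}.$$ *)

(* Defs.v *)
From HB Require Import structures.
From mathcomp Require Import all_boot all_order all_algebra.
From mathcomp Require Import all_classical all_reals all_analysis.

Set Implicit Arguments.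
Unset Strict Implicit.
Unset Printing Implicit Defensive.

Import Order.TTheory GRing.Theory Num.Theory.
Import numFieldNormedType.Exports.

Local Open Scope classical_set_scope.
Local Open Scope ring_scope.

(* [f] is of class C^k on [U]; meant for open [U], so that the derivatives at
   the points of [U] only see the values of [f] on [U]. *)
Fixpoint Ck (R : realType) (V W : normedModType R) (k : nat) (U : set V)
    (f : V -> W) : Prop :=
  if k is k'.+1 then
    (forall x, U x -> differentiable f x) /\
    (forall v : V, Ck k' U (fun x => 'D_v f x))
  else forall x, U x -> {for x, continuous f}.

Record chart (R : realType) (m : nat) (M : topologicalType) := Chart {
  chart_dom : set M;
  chart_cod : set 'rV[R]_m;
  to_coord : M -> 'rV[R]_m;
  of_coord : 'rV[R]_m -> M;
  chart_dom_open : open chart_dom;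
  chart_cod_open : open chart_cod;
  to_coord_cod : forall p, chart_dom p -> chart_cod (to_coord p);
  of_coord_dom : forall y, chart_cod y -> chart_dom (of_coord y);
  to_coordK : forall p, chart_dom p -> of_coord (to_coord p) = p;
  of_coordK : forall y, chart_cod y -> to_coord (of_coord y) = y;
  to_coord_continuous : forall p, chart_dom p -> {for p, continuous to_coord};
  of_coord_continuous : forall y, chart_cod y -> {for y, continuous of_coord}
}.

Record manifold (R : realType) (m : nat) (M : topologicalType) := Manifold {
  atlas : set (chart R m M);
  manifold_hausdorff : hausdorff_space M;
  manifold_second_countable : @second_countable M;
  atlas_cover : forall p, exists2 c, atlas c & chart_dom c p;
  atlas_smooth : forall c d, atlas c -> atlas d -> forall r,
    Ck r (chart_cod c `&` of_coord c @^-1` chart_dom d)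
      (to_coord d \o of_coord c)
}.

Section DiscreteLagrangian.
Context {R : realType} {m : nat} {M : topologicalType}.
Implicit Types (c d : chart R m M) (L : M -> M -> R).

Definition coord_lagrangian L c d : 'rV[R]_m * 'rV[R]_m -> R :=
  fun z => L (of_coord c z.1) (of_coord d z.2).

Definition C2_lagrangian (S : manifold R m M) L : Prop :=
  forall c d, atlas S c -> atlas S d ->
    Ck 2 (chart_cod c `*` chart_cod d) (coord_lagrangian L c d).

(* [x] is a sequence of points and [phi i] a chart around [x i]; the chart
   identifies the tangent space of M at [x i] and its dual with row vectors. *)
Variables (L : M -> M -> R) (phi : int -> chart R m M) (x : int -> M).

Let Lc (i : int) := coord_lagrangian L (phi i) (phi (i + 1)).
Let pt (i : int) := (to_coord (phi i) (x i), to_coord (phi (i + 1)) (x (i + 1))).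
Let e1 (a : 'I_m) : 'rV[R]_m * 'rV[R]_m := (delta_mx 0 a, 0).
Let e2 (a : 'I_m) : 'rV[R]_m * 'rV[R]_m := (0, delta_mx 0 a).

Definition d1L (i : int) : 'rV[R]_m := \row_a 'D_(e1 a) (Lc i) (pt i).
Definition d2L (i : int) : 'rV[R]_m := \row_a 'D_(e2 a) (Lc i) (pt i).

Definition d11L (i : int) : 'M[R]_m :=
  \matrix_(a, b) 'D_(e1 a) (fun z => 'D_(e1 b) (Lc i) z) (pt i).
Definition d22L (i : int) : 'M[R]_m :=
  \matrix_(a, b) 'D_(e2 a) (fun z => 'D_(e2 b) (Lc i) z) (pt i).
Definition d12L (i : int) : 'M[R]_m :=
  \matrix_(a, b) 'D_(e1 a) (fun z => 'D_(e2 b) (Lc i) z) (pt i).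

Definition lagrangian_trajectory : Prop := forall i, d2L (i - 1) + d1L i = 0.

Definition varA (i : int) : 'M[R]_m := d22L (i - 1) + d11L i.
Definition varB (i : int) : 'M[R]_m := - d12L i.

End DiscreteLagrangian.

Definition nperiodic (T : Type) (n : nat) (u : int -> T) : Prop :=
  forall i, u (i + n%:Z) = u i.

Definition pairing (R : realType) (m : nat) (xi v : 'rV[R]_m) : R :=
  (xi *m v^T) 0 0.

(* Negative index on the set [U] (a subspace in all uses) of the symmetric
   bilinear form [b]. *)
Definition neg_index (R : realType) (V : vectType R) (b : V -> V -> R)
    (U : set V) : nat :=
  \max_(d < (\dim {:V}).+1 | `[< exists D : {vspace V}, \dim D = d /\
     (forall v, v \in D -> U v /\ (v != 0 -> b v v < 0)) >]) d.

Definition mx_form (R : realType) (k : nat) (S : 'M[R]_k) (u v : 'rV[R]_k) : R :=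
  pairing (u *m S) v.

Definition mx_neg_index (R : realType) (k : nat) (S : 'M[R]_k) : nat :=
  neg_index (mx_form S) [set: 'rV[R]_k].

(* Row-vector conventions: [A i : E_i -> E_i^*] is [u |-> u *m A i],
   [B i : E_i -> E_{i+1}^*] is [u |-> u *m B i], and its adjoint
   [E_{i+1} -> E_i^*] is [v |-> v *m (B i)^T]. *)
Section VariationalSystem.
Context {R : realType} {m : nat}.
Variables (n : nat) (A B : int -> 'M[R]_m).

Local Notation E := 'rV[R]_m.
Local Notation W := ('rV[R]_m * 'rV[R]_m)%type.
Local Notation X := {ffun 'I_n -> 'rV[R]_m}.

Definition var_op (u : int -> E) (i : int) : E :=
  u i *m A i - u (i - 1) *m B (i - 1) - u (i + 1) *m (B i)^T.

Definition var_trajectory (u : int -> E) : Prop := forall i, var_op u i = 0.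

(* (u_{i-1}, u_i) |-> (u_i, u_{i+1}) *)
Definition var_step (i : int) (p : W) : W :=
  (p.2, (p.2 *m A i - p.1 *m B (i - 1)) *m invmx (B i)^T).

(* (u_0, u_1) |-> (u_j, u_{j+1}) *)
Fixpoint var_flow (j : nat) (p : W) : W :=
  if j is j'.+1 then var_step j (var_flow j' p) else p.

Definition poincare : 'End(W) := linfun (var_flow n).

Fact var_flow_linear j : linear (var_flow j).
Proof.
elim: j => [|j IH] a p q //=; rewrite IH /var_step.
congr pair => /=.
by rewrite scalemxAl -mulmxDl scalerBr !mulmxDl -!scalemxAl opprD !mulmxDl addrACA.
Qed.

Fact poincare_trajectory (u : int -> E) :
  (forall i, B i \in unitmx) -> var_trajectory u ->
  poincare (u 0, u 1) = (u n%:Z, u (n%:Z + 1)).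
Proof.
move=> Bu uT.
pose lin := GRing.isLinear.Build _ _ _ _ (var_flow n) (var_flow_linear n).
pose F : {linear W -> W} := HB.pack (var_flow n) lin.
rewrite /poincare (lfunE F) /=.
elim: (n) => [|j IH]; first by rewrite add0r.
rewrite [LHS]/= IH /var_step /=.
have jS : j.+1%:Z = j%:Z + 1 by rewrite -addn1 PoszD.
have := uT j.+1%:Z; rewrite /var_op jS addrK => /eqP.
by rewrite subr_eq0 => /eqP ->; rewrite mulmxK // unitmx_tr -jS.
Qed.

Definition symp (p q : W) : R :=
  pairing (p.1 *m B 0) q.2 - pairing (q.1 *m B 0) p.2.

(* The n-periodic sequence of an element of E_1 x ... x E_n; the factors are
   indexed by residues mod n, so the factor E_n has index 0. *)
Definition per_ext (u : X) (i : int) : E :=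
  if insub `|(i %% n%:Z)%Z|%N is Some j then u j else 0.

Definition action_hessian (u v : X) : R :=
  \sum_(1 <= i < n.+1) pairing (var_op (per_ext u) i%:Z) (per_ext v i%:Z).

Section Reduction.
Context {k : nat}.
Variable w : 'I_k -> int -> E.

Definition Gmx (i : int) : 'M[R]_k :=
  \matrix_(a, b) pairing (w a i *m B i) (w b (i + 1)).

Definition Gbar : 'M[R]_k := \sum_(1 <= i < n.+1) invmx (Gmx i%:Z).

Definition Zspace : set X :=
  [set v | forall i : int, per_ext v i \in <<[seq w a i | a <- enum 'I_k]>>%VS].

Definition Xperp : set X :=
  [set v | forall (i : int) (a : 'I_k),
     pairing (w a (i - 1) *m B (i - 1)) (per_ext v i) = 0].

Definition hessian_perp (u v : X) : R :=
  action_hessian u v -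
  \sum_(1 <= i < n.+1) \sum_(a < k) \sum_(b < k)
    invmx (Gmx i%:Z) a b
    * pairing (per_ext u i%:Z *m B i%:Z) (w a (i%:Z + 1))
    * pairing (per_ext v i%:Z *m B i%:Z) (w b (i%:Z + 1)).

Definition Amx (S : 'M[R]_k) : 'M[R]_k := S *m invmx Gbar *m S - S.

Definition Amx_perp (S : 'M[R]_k) : 'M[R]_k := S - Gbar.

End Reduction.
End VariationalSystem.

Arguments action_hessian {R m} n A B u v.
Arguments Zspace {R m} n {k} w _.
Arguments Xperp {R m} n B {k} w _.
Arguments hessian_perp {R m} n A B {k} w u v.

(* Main.v *)
Require Import Defs.
From HB Require Import structures.
From mathcomp Require Import all_boot all_order all_algebra.
From mathcomp Require Import all_classical all_reals all_analysis.
From mathcomp Require Import ring lra zify.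
Import Order.TTheory GRing.Theory Num.Theory.
Import numFieldNormedType.Exports.
Local Open Scope classical_set_scope.
Local Open Scope ring_scope.


(** Write [u i] for the value at [i] of a sequence, [W i] for the matrix whose
    rows are the [w^a_i], [b_i(u)] for the row vector of the
    [<B_i u_i, w^a_{i+1}>], and [Delta z i] for [z (i + 1) - z i].

    Since the [w^a] are trajectories, a periodic span sequence [z W] satisfies,
    for every [v] in the reduced space [X^perp],
    [h(z W, z' W + v) = sum_i <Delta z i, Delta z' i *m G_i - b_i(v)>]
    ([hess_span]).  Hence [v] becomes [h]-orthogonal to [Z] after adding the span
    sequence [z' W] with [Delta z' i = (b_i(v) - c(v) Gbar^-1) G_i^-1], where
    [c(v) = sum_i b_i(v) G_i^-1]; the constant term makes the increments sum to
    zero over a period, so that [z'] is periodic ([corr_diff]).  On the corrected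
    vector [h] takes the value [h^perp(v, v) + c(v) Gbar^-1 c(v)^T]
    ([hess_Tseq]).  Therefore the index of [h] is that of [h] on [Z] plus that of
    [h^perp + c Gbar^-1 c] on the reduced space ([neg_index_reduction]).

    It remains to compare the last form with [h^perp].  Let [u^t] be the
    trajectory of [sum_a t_a q_a], and split it as [u^t = z W + y^t] with [y^t]
    in the annihilator.  Over a period [u^t] changes by [t S W], hence [y^t] is
    periodic and [z] changes by [t S].  Conservation of the symplectic form gives
    [Delta z i = (t + b_i(y^t)) G_i^-1] ([coord_diff]).  Summing over a period
    yields [c(y^t) = t (S - Gbar)] ([cseq_ymap]), and pairing the equation of the
    trajectory with [v] yields [h^perp(y^t, v) = <t, c(v)>] ([perp_ymap]).  So the
    reduced space is the orthogonal sum, for both forms, of the span of the [y^t]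
    and of the kernel of [c], where the two forms coincide.  On the first summand
    [h^perp] has matrix [M = S - Gbar], which is [A^perp], and the other form has
    matrix [M Gbar^-1 M + M], which is [A] ([neg_index_perturbation]).

    The matrices [A_i] are symmetric because the second derivatives of a C^2
    function commute ([derive_commute]). *)

Set Implicit Arguments.
Unset Strict Implicit.
Unset Printing Implicit Defensive.

Lemma linfun_funE (K : fieldType) (V1 V2 : vectType K) (f : V1 -> V2) :
  linear f -> forall v, linfun f v = f v.
Proof.
move=> f_lin v; pose lin := GRing.isLinear.Build _ _ _ _ f f_lin.
pose F : {linear V1 -> V2} := HB.pack f lin.
exact: (lfunE F v).
Qed.

(** * The negative index of a symmetric bilinear form *)

(** Additivity and homogeneity are only asked in the first argument: symmetry
    gives them in the second one. *)
Definition sym_bilinear (R : realType) (V : lmodType R) (b : V -> V -> R) :=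
  (forall u v, b u v = b v u) /\
  (forall a u v z, b (a *: u + v) z = a * b u z + b v z).

Section SymBilinear.
Variables (R : realType) (V : lmodType R) (b : V -> V -> R).
Hypothesis bP : sym_bilinear b.

Lemma sbC u v : b u v = b v u. Proof. exact: bP.1. Qed.
Lemma sbPl a u v z : b (a *: u + v) z = a * b u z + b v z.
Proof. exact: bP.2. Qed.
Lemma sbDl u v z : b (u + v) z = b u z + b v z.
Proof. by have := sbPl 1 u v z; rewrite scale1r mul1r. Qed.
Lemma sb0l z : b 0 z = 0.
Proof. by apply: (addrI (b 0 z)); rewrite -sbDl !addr0. Qed.
Lemma sbZl a u z : b (a *: u) z = a * b u z.
Proof. by have := sbPl a u 0 z; rewrite addr0 sb0l addr0. Qed.
Lemma sbDr z u v : b z (u + v) = b z u + b z v.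
Proof. by rewrite sbC sbDl !(sbC z). Qed.
Lemma sbZr a u z : b z (a *: u) = a * b z u.
Proof. by rewrite sbC sbZl (sbC z). Qed.
Lemma sb0r z : b z 0 = 0.
Proof. by rewrite sbC sb0l. Qed.
Lemma sbBl u v z : b (u - v) z = b u z - b v z.
Proof. by rewrite -scaleN1r addrC sbPl mulN1r addrC. Qed.
Lemma sbBr z u v : b z (u - v) = b z u - b z v.
Proof. by rewrite sbC sbBl !(sbC z). Qed.

End SymBilinear.

Section NegIndex.
Variables (R : realType) (V : vectType R).
Implicit Types (b : V -> V -> R) (U D P : {vspace V}).

(** A decomposition into a negative definite and a nonnegative subspace
    computes the index, even when the form is degenerate and without assuming
    that the two parts are orthogonal. *)
Lemma neg_index_sum b D P :
  (forall v, v \in D -> v != 0 -> b v v < 0) ->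
  (forall v, v \in P -> 0 <= b v v) ->
  neg_index b [set v | v \in (D + P)%VS] = \dim D.
Proof.
move=> Dneg Ppos; apply/eqP; rewrite eqn_leq; apply/andP; split.
- apply/bigmax_leqP => d /asboolP[D' [<- D'neg]].
  have D'P0 : (D' :&: P)%VS = 0%VS.
    apply/eqP; rewrite -subv0; apply/subvP => v.
    rewrite memv_cap memv0 => /andP[D'v Pv]; case: eqVneq => // v0.
    by have := (D'neg v D'v).2 v0; rewrite ltNge Ppos.
  have := dimv_sum_cap D' P; rewrite D'P0 dimv0 addn0 => D'P.
  have sub : (D' + P <= D + P)%VS.
    rewrite subv_add addvSr andbT.
    by apply/subvP => v /D'neg[].
  have := dimvS sub; rewrite D'P => /leq_trans/(_ (dimv_add_leqif D P).1).
  by rewrite leq_add2r.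
- have Dle : (\dim D < (\dim {:V}).+1)%N by rewrite ltnS dimvS ?subvf.
  have := @leq_bigmax_cond _ (fun d : 'I_(\dim {:V}).+1 => `[< exists D0 : {vspace V},
    \dim D0 = d /\ (forall v, v \in D0 -> [set v | v \in (D + P)%VS] v /\
      (v != 0 -> b v v < 0)) >]) (fun d => d : nat) (Ordinal Dle).
  apply; apply/asboolP; exists D; split=> // v Dv; split; last exact: Dneg.
  by apply: (subvP (addvSl D P)).
Qed.

Lemma neg_index_eq b1 b2 (U : set V) :
  (forall v, U v -> b1 v v = b2 v v) -> neg_index b1 U = neg_index b2 U.
Proof.
move=> b12; rewrite /neg_index; apply: eq_bigl => d.
apply/asboolP/asboolP => -[D [dD DU]]; exists D; split=> // v /DU[Uv vneg];
  split=> // /vneg; by rewrite b12.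
Qed.

Variables (b : V -> V -> R).
Hypothesis bP : sym_bilinear b.

Lemma neg_decomposition U : exists D P, [/\ (D + P)%VS = U,
  forall v, v \in D -> v != 0 -> b v v < 0 &
  forall v, v \in P -> 0 <= b v v].
Proof.
have [s Us] := ubnP (\dim U); elim: s => // s IH in U Us *.
have [Upos|/existsNP[u /not_implyP[Uu /negP]]] :=
  pselect (forall v, v \in U -> 0 <= b v v).
  exists 0%VS, U; split=> //; first by rewrite add0v.
  by move=> v; rewrite memv0 => /eqP ->; rewrite eqxx.
rewrite -ltNge => bu.
(* Split off the negative line of [u] and recurse on its orthogonal in [U]. *)
pose f : 'Hom(V, R^o) := linfun (fun v => b v u : R^o).
have fE v : f v = b v u by apply: linfun_funE => a x y; apply: sbPl.
pose U' := (U :&: lker f)%VS.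
have U'b v : v \in U' -> b v u = 0.
  by rewrite memv_cap memv_ker fE => /andP[_ /eqP].
have U'U : (U' <= U)%VS by rewrite capvSl.
have /IH[D' [P' [DP' D'neg P'pos]]] : (\dim U' < s)%N.
  rewrite ltnS in Us; apply: leq_trans Us.
  rewrite (ltn_leqif (dimv_leqif_sup U'U)); apply/negP => /subvP/(_ u Uu)/U'b.
  by move=> bu0; rewrite bu0 ltxx in bu.
have UE : (<[u]> + U')%VS = U.
  apply/eqP; rewrite eqEsubv subv_add -memvE Uu U'U /=.
  apply/subvP => v Uv; rewrite -[v](subrKC (b v u / b u u *: u)).
  rewrite memv_add ?memvZ ?memv_line // memv_cap memv_ker fE.
  rewrite rpredB ?memvZ //= (sbBl bP) (sbZl bP) divfK ?subrr //.
  by rewrite lt_eqF.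
exists (<[u]> + D')%VS, P'; split=> //; first by rewrite -addvA DP'.
move=> v /memv_addP[_ /vlineP[a ->] [d D'd ->]] ad0.
have db : b d u = 0 by apply: U'b; rewrite -DP' (subvP (addvSl _ _)).
have -> : b (a *: u + d) (a *: u + d) = a ^+ 2 * b u u + b d d.
  rewrite (sbPl bP) !(sbDr bP) !(sbZr bP) (sbC bP u d) db; ring.
have [d0|d0] := eqVneq d 0.
  rewrite d0 (sb0l bP) addr0 nmulr_llt0 // exprn_even_gt0 //=.
  by apply: contraNneq ad0 => ->; rewrite d0 scale0r addr0.
by rewrite ltr_wnDl ?D'neg // mulr_ge0_le0 ?sqr_ge0 // ltW.
Qed.

Lemma neg_index_orthoD U1 U2 :
  (forall u v, u \in U1 -> v \in U2 -> b u v = 0) ->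
  neg_index b [set v | v \in (U1 + U2)%VS] =
    (neg_index b [set v | v \in U1] + neg_index b [set v | v \in U2])%N.
Proof.
have [D1 [P1 [<- D1n P1p]]] := neg_decomposition U1.
have [D2 [P2 [<- D2n P2p]]] := neg_decomposition U2.
move=> ortho; rewrite (neg_index_sum D1n P1p) (neg_index_sum D2n P2p).
have DD u v : u \in D1 -> v \in D2 -> b u v = 0.
  by move=> Du Dv; apply: ortho; apply: (subvP (addvSl _ _)).
have PP u v : u \in P1 -> v \in P2 -> b u v = 0.
  by move=> Du Dv; apply: ortho; apply: (subvP (addvSr _ _)).
have bD u v : b u v = 0 -> b (u + v) (u + v) = b u u + b v v.
  move=> uv0; rewrite (sbDl bP) !(sbDr bP) (sbC bP v u) uv0; ring.
have -> : (D1 + P1 + (D2 + P2) = (D1 + D2) + (P1 + P2))%VS.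
  by rewrite -!addvA; congr (_ + _)%VS; rewrite !addvA (addvC P1).
rewrite neg_index_sum.
- rewrite -dimv_sum_cap; suff -> : (D1 :&: D2)%VS = 0%VS by rewrite dimv0 addn0.
  apply/eqP; rewrite -subv0; apply/subvP => v.
  rewrite memv_cap memv0 => /andP[D1v D2v]; case: eqVneq => // v0.
  by have := D1n v D1v v0; rewrite (DD v v) // ltxx.
- move=> _ /memv_addP[u Du [v Dv ->]] uv0; rewrite (bD _ _ (DD _ _ Du Dv)).
  have [u0|u0] := eqVneq u 0.
    rewrite u0 (sb0l bP) add0r D2n //.
    by apply: contraNneq uv0 => ->; rewrite u0 addr0.
  have [v0|v0] := eqVneq v 0; first by rewrite v0 (sb0l bP) addr0 D1n.
  by have := ltrD (D1n u Du u0) (D2n v Dv v0); rewrite addr0.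
- move=> _ /memv_addP[u Du [v Dv ->]].
  rewrite (bD _ _ (PP _ _ Du Dv)).
  by apply: addr_ge0; [exact: P1p|exact: P2p].
Qed.

End NegIndex.

(** The map need not be injective: its kernel is isotropic for the pulled back
    form. *)
Lemma neg_index_img (R : realType) (V1 V2 : vectType R) (f : 'Hom(V1, V2))
    (b1 : V1 -> V1 -> R) (b2 : V2 -> V2 -> R) (U : {vspace V1}) :
  sym_bilinear b1 -> sym_bilinear b2 ->
  (forall v, v \in U -> b2 (f v) (f v) = b1 v v) ->
  neg_index b2 [set v | v \in (f @: U)%VS] = neg_index b1 [set v | v \in U].
Proof.
move=> b1P b2P; have [D [P [<- Dn Pp]]] := neg_decomposition b1P U.
move=> fb; rewrite limgD (neg_index_sum Dn Pp) //.
have fD v : v \in D -> b2 (f v) (f v) = b1 v v.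
  by move=> Dv; rewrite fb // (subvP (addvSl _ _)).
rewrite neg_index_sum.
- apply: limg_dim_eq; apply/eqP; rewrite -subv0; apply/subvP => v.
  rewrite memv_cap memv_ker memv0 => /andP[Dv /eqP fv0].
  case: eqVneq => // v0.
  by have := Dn v Dv v0; rewrite -fD // fv0 (sb0l b2P) ltxx.
- move=> _ /memv_imgP[v Dv ->] fv0; rewrite fD // Dn //.
  by apply: contraNneq fv0 => ->; rewrite linear0.
- by move=> _ /memv_imgP[v Pv ->]; rewrite fb ?Pp // (subvP (addvSr _ _)).
Qed.

Lemma pairingC (R : realType) m (u v : 'rV[R]_m) : pairing u v = pairing v u.
Proof. by rewrite /pairing -[u in LHS]trmxK -trmx_mul mxE. Qed.

Lemma pairingPl (R : realType) m a (u v z : 'rV[R]_m) :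
  pairing (a *: u + v) z = a * pairing u z + pairing v z.
Proof. by rewrite /pairing mulmxDl -scalemxAl !mxE. Qed.

Lemma pairing_bilinear (R : realType) m : sym_bilinear (@pairing R m).
Proof. by split=> *; [apply: pairingC|apply: pairingPl]. Qed.

Lemma pairing_mulmx (R : realType) m p (A : 'M[R]_(m, p)) u v :
  pairing (u *m A) v = pairing u (v *m A^T).
Proof. by rewrite /pairing trmx_mul trmxK mulmxA. Qed.

Lemma mx_form_bilinear (R : realType) k (S : 'M[R]_k) :
  S^T = S -> sym_bilinear (mx_form S).
Proof.
move=> ST; split=> [u v|a u v z]; rewrite /mx_form.
  by rewrite pairingC pairing_mulmx ST pairingC pairing_mulmx ST.
by rewrite mulmxDl -scalemxAl pairingPl.
Qed.

(** * Splitting off the span of a family of linear forms *)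

(** Here [c] collects [k] linear forms on [Y] that are represented in [b] by
    the vectors [y t] of [Y], with invertible Gram matrix [M].  Then [Y] is the
    orthogonal sum of [y @: fullv] and [Y :&: lker c], both for [b] and for its
    perturbation by the form [K] pulled back along [c], and only the first
    summand sees the perturbation.  The form [b] may be degenerate on [Y]. *)
Lemma neg_index_perturbation (R : realType) (X : vectType R) (k : nat)
    (b : X -> X -> R) (Y : {vspace X}) (c : 'Hom(X, 'rV[R]_k))
    (y : 'Hom('rV[R]_k, X)) (K M : 'M[R]_k) :
  sym_bilinear b -> K^T = K -> M \in unitmx ->
  (forall t, y t \in Y) ->
  (forall t v, v \in Y -> b (y t) v = pairing t (c v)) ->
  (forall t, c (y t) = t *m M) ->
  let b' u v := b u v + mx_form K (c u) (c v) in
  (neg_index b' [set v | v \in Y] + mx_neg_index M =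
   neg_index b [set v | v \in Y] + mx_neg_index (M *m K *m M + M))%N.
Proof.
move=> bP KT Mu yY yb cy b'.
have KP := mx_form_bilinear KT.
have b'P : sym_bilinear b'.
  split=> [u v|a u v z]; rewrite /b'; first by rewrite (sbC bP) (sbC KP).
  rewrite linearP (sbPl bP) (sbPl KP); ring.
have MT : M^T = M.
  have tMt t t' : pairing t' (t *m M^T) = pairing t' (t *m M).
    rewrite -(cy t) -yb // (sbC bP) yb // cy.
    by rewrite pairingC pairing_mulmx trmxK.
  apply/matrixP => i j; rewrite mxE; have := tMt (delta_mx 0 i) (delta_mx 0 j).
  by rewrite /pairing -!rowE !mxE.
have MKMT : (M *m K *m M + M)^T = M *m K *m M + M.
  by rewrite raddfD /= !trmx_mul MT KT mulmxA.
have YE : Y = (y @: fullv + Y :&: lker c)%VS.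
  apply/eqP; rewrite eqEsubv subv_add capvSl andbT; apply/andP; split.
    apply/subvP => v Yv; rewrite -[v](subrKC (y (c v *m invmx M))).
    rewrite memv_add ?memv_img ?memvf // memv_cap memv_ker rpredB //=.
    by rewrite linearB /= cy mulmxKV // subrr.
  by apply/subvP => _ /memv_imgP[t _ ->].
have ortho u v : u \in (y @: fullv)%VS -> v \in (Y :&: lker c)%VS -> b u v = 0.
  move=> /memv_imgP[t _ ->]; rewrite memv_cap memv_ker => /andP[Yv /eqP cv].
  by rewrite yb // cv (sb0r (@pairing_bilinear _ _)).
have ortho' u v :
    u \in (y @: fullv)%VS -> v \in (Y :&: lker c)%VS -> b' u v = 0.
  move=> yu vc; rewrite /b' ortho // add0r.
  by move: vc; rewrite memv_cap memv_ker => /andP[_ /eqP ->]; rewrite (sb0r KP).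
have full : [set v : 'rV[R]_k | v \in fullv] = [set: 'rV[R]_k].
  by apply/seteqP; split=> // v _ /=; rewrite memvf.
have byt t : b (y t) (y t) = mx_form M t t.
  by rewrite yb // cy pairingC.
have b'yt t : b' (y t) (y t) = mx_form (M *m K *m M + M) t t.
  rewrite /b' byt cy /mx_form mulmxDr (sbDl (@pairing_bilinear _ _)) addrC.
  by congr (_ + _); rewrite !mulmxA [RHS]pairing_mulmx MT.
rewrite YE (neg_index_orthoD bP ortho) (neg_index_orthoD b'P ortho').
rewrite (neg_index_img (mx_form_bilinear MT) bP) => [|t _]; last exact: byt.
rewrite (neg_index_img (mx_form_bilinear MKMT) b'P) => [|t _]; last exact: b'yt.
have -> : neg_index b' [set v | v \in (Y :&: lker c)%VS] =
          neg_index b [set v | v \in (Y :&: lker c)%VS].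
  apply: neg_index_eq => v /=; rewrite memv_cap memv_ker => /andP[_ /eqP cv].
  by rewrite /b' cv (sb0l KP) addr0.
rewrite full -!/(mx_neg_index _); lia.
Qed.

(** The map [T] corrects each vector of [Y] by a vector of [Z] so that it
    becomes orthogonal to [Z]. *)
Lemma neg_index_reduction (R : realType) (X : vectType R)
    (h b : X -> X -> R) (Z Y : {vspace X}) (T : 'End(X)) :
  sym_bilinear h -> sym_bilinear b -> (Z + Y)%VS = fullv ->
  (forall v, v \in Y -> T v - v \in Z) ->
  (forall z v, z \in Z -> v \in Y -> h z (T v) = 0) ->
  (forall v, v \in Y -> h (T v) (T v) = b v v) ->
  neg_index h [set: X] =
    (neg_index h [set v | v \in Z] + neg_index b [set v | v \in Y])%N.
Proof.
move=> hP bP ZY TZ hT hTT.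
have -> : [set: X] = [set v | v \in (Z + T @: Y)%VS].
  apply/seteqP; split=> // v _ /=.
  have : v \in (Z + Y)%VS by rewrite ZY memvf.
  move=> /memv_addP[z Zz [u Yu ->]].
  have -> : z + u = (z - (T u - u)) + T u by rewrite opprB addrA subrK.
  by rewrite memv_add ?memv_img // rpredB // TZ.
rewrite (neg_index_orthoD hP); last first.
  by move=> z _ Zz /memv_imgP[v Yv ->]; apply: hT.
by rewrite (neg_index_img bP hP).
Qed.

Lemma pairing_suml (R : realType) m I (r : seq I) (F : I -> 'rV[R]_m) v :
  \sum_(i <- r) pairing (F i) v = pairing (\sum_(i <- r) F i) v.
Proof.
apply/esym/(big_morph (fun u => pairing u v)) => [x y|].
  exact: (sbDl (@pairing_bilinear _ _)).
exact: (sb0l (@pairing_bilinear _ _)).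
Qed.

Lemma pairing_sumr (R : realType) m I (r : seq I) (F : I -> 'rV[R]_m) u :
  \sum_(i <- r) pairing u (F i) = pairing u (\sum_(i <- r) F i).
Proof. by rewrite pairingC -pairing_suml; apply: eq_bigr => i _; apply: pairingC. Qed.

(** * Symmetry of second derivatives *)

Section Schwarz.
Variables (R : realType) (V : normedModType R) (f : V -> R) (U : set V).
Hypotheses (Uopen : open U) (fC2 : Ck 2 U f).

Lemma is_derive_line (g : V -> R) (p u : V) (s : R) :
  differentiable g (p + s *: u) ->
  is_derive s 1 (fun r : R => g (p + r *: u)) ('D_u g (p + s *: u)).
Proof.
move=> gdiff; have dg : derivable g (p + s *: u) u by exact: diff_derivable.
have E : (fun h : R => h^-1 *: (((fun r : R => g (p + r *: u)) \o shift s)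
            (h *: (1 : R)) - g (p + s *: u))) =
         (fun h : R => h^-1 *: ((g \o shift (p + s *: u)) (h *: u) - g (p + s *: u))).
  apply/funext => h /=; rewrite /shift /=; congr (_ *: (g _ - _)).
  by rewrite [h *: (1 : R)]mulr1 scalerDl addrCA.
by split; rewrite /derivable /derive /= E.
Qed.

(** The mean value theorem applied to both variables of the second difference
    of [f] over a parallelogram. *)
Lemma second_difference (x u v : V) (s : R) : 0 < s ->
  (forall a b : R, 0 <= a <= s -> 0 <= b <= s -> U (x + a *: u + b *: v)) ->
  exists a b : R, [/\ 0 <= a <= s, 0 <= b <= s &
    f (x + s *: u + s *: v) - f (x + s *: u) - f (x + s *: v) + f x =
    'D_v (fun z => 'D_u f z) (x + a *: u + b *: v) * s * s].
Proof.
move=> s0 sU.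
have s0' : 0 <= s by rewrite ltW.
have ss : 0 <= s <= s by apply/andP.
have zs : 0 <= (0 : R) <= s by apply/andP.
have dline b a : 0 <= b <= s -> 0 <= a <= s ->
  is_derive a 1 (fun r : R => f (x + b *: v + r *: u)) ('D_u f (x + b *: v + a *: u)).
  move=> bs as_; apply: is_derive_line; apply: fC2.1.
  by rewrite addrAC; apply: sU.
have dphi a : 0 <= a <= s ->
  is_derive a 1 (fun r : R => f (x + s *: v + r *: u) - f (x + r *: u))
    ('D_u f (x + s *: v + a *: u) - 'D_u f (x + a *: u)).
  move=> as_; apply: is_deriveB; first exact: dline.
  by have := dline 0 a zs as_; rewrite scale0r addr0.
have inc a : a \in `]0, s[%R -> 0 <= a <= s.
  by rewrite in_itv /= => /andP[a0 as_]; rewrite !ltW.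
have [||a aI Ea] := @MVT R (fun r : R => f (x + s *: v + r *: u) - f (x + r *: u))
    (fun a => 'D_u f (x + s *: v + a *: u) - 'D_u f (x + a *: u)) 0 s s0.
- by move=> a /inc; apply: dphi.
- apply: derivable_within_continuous => a; rewrite in_itv /= => as_.
  by have [] := dphi a as_.
have dpsi b : 0 <= b <= s ->
  is_derive b 1 (fun r : R => 'D_u f (x + a *: u + r *: v))
    ('D_v (fun z => 'D_u f z) (x + a *: u + b *: v)).
  move=> bs; apply: is_derive_line; apply: (fC2.2 u).1.
  by apply: sU => //; apply: inc.
have [||b bI Eb] := @MVT R (fun r : R => 'D_u f (x + a *: u + r *: v))
    (fun b => 'D_v (fun z => 'D_u f z) (x + a *: u + b *: v)) 0 s s0.
- by move=> b /inc; apply: dpsi.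
- apply: derivable_within_continuous => b; rewrite in_itv /= => bs.
  by have [] := dpsi b bs.
exists a, b; split; [exact: inc|exact: inc|].
rewrite subr0 scale0r addr0 in Eb; rewrite -Eb.
rewrite subr0 !scale0r !addr0 [x + s *: v + a *: u]addrAC in Ea.
rewrite -Ea [x + s *: u + s *: v]addrAC; ring.
Qed.

Lemma derive_commute (x u v : V) : U x ->
  'D_u (fun z => 'D_v f z) x = 'D_v (fun z => 'D_u f z) x.
Proof.
move=> Ux; set g1 := (fun z => 'D_u (fun z' => 'D_v f z') z).
set g2 := (fun z => 'D_v (fun z' => 'D_u f z') z).
rewrite -[LHS]/(g1 x) -[RHS]/(g2 x); apply/eqP/negPn/negP => g12.
pose e := `|g1 x - g2 x| / 2.
have e0 : 0 < e by rewrite divr_gt0 // normr_gt0 subr_eq0.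
have c1 : \forall z \near x, `|g1 x - g1 z| < e.
  by have /cvgr_dist_lt/(_ e e0) := (fC2.2 v).2 u x Ux.
have c2 : \forall z \near x, `|g2 x - g2 z| < e.
  by have /cvgr_dist_lt/(_ e e0) := (fC2.2 u).2 v x Ux.
have cU : \forall z \near x, U z by apply: open_nbhs_nbhs.
have : nbhs x [set z | (`|g1 x - g1 z| < e /\ `|g2 x - g2 z| < e) /\ U z].
  exact: (filterI (filterI c1 c2) cU).
move=> /nbhs_ballP[r /= r0 rU].
(* With this side the parallelograms stay in the ball of radius [r]. *)
pose s := r / (`|u| + `|v| + 1) / 2.
have uv0 : 0 < `|u| + `|v| + 1 by rewrite ltr_wpDl // addr_ge0.
have s0 : 0 < s by rewrite !divr_gt0.
have sball (u' v' : V) (a b : R) : `|u'| + `|v'| = `|u| + `|v| ->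
    0 <= a <= s -> 0 <= b <= s -> ball x r (x + a *: u' + b *: v').
  move=> uv' /andP[a0 as_] /andP[b0 bs]; rewrite -ball_normE /ball_ /=.
  rewrite -addrA opprD addNKr normrN.
  apply: (le_lt_trans (ler_normD _ _)); rewrite !normrZ !ger0_norm //.
  apply: (@le_lt_trans _ _ (s * (`|u| + `|v|))).
    by rewrite -uv' mulrDr lerD // ler_wpM2r.
  have -> : r = s * (2 * (`|u| + `|v| + 1)).
    by rewrite /s; field; rewrite gt_eqF.
  rewrite ltr_pM2l //; have := normr_ge0 u; have := normr_ge0 v; lra.
have [|a1 [b1 [a1s b1s E1]]] := @second_difference x u v s s0.
  by move=> a b as_ bs; apply: (rU _ (sball u v a b _ as_ bs)).2.
have [|a2 [b2 [a2s b2s E2]]] := @second_difference x v u s s0.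
  by move=> a b as_ bs; apply: (rU _ (sball v u a b _ as_ bs)).2; rewrite addrC.
have [[_ h2] _] := rU _ (sball u v a1 b1 erefl a1s b1s).
have [[h1 _] _] := rU _ (sball v u a2 b2 (addrC _ _) a2s b2s).
have E : g2 (x + a1 *: u + b1 *: v) = g1 (x + a2 *: v + b2 *: u).
  apply: (mulIf (lt0r_neq0 s0)); apply: (mulIf (lt0r_neq0 s0)).
  transitivity (f (x + s *: u + s *: v) - f (x + s *: u) - f (x + s *: v) + f x).
    exact: esym E1.
  apply: etrans E2; rewrite [x + s *: v + s *: u]addrAC.
  by congr (_ + _); apply: addrAC.
rewrite E in h2.
have far (p q r' : R) : `|p - r'| < `|p - q| / 2 -> `|q - r'| < `|p - q| / 2 -> False.
  move=> hp hq; have := ltrD hp hq; rewrite -splitr; apply/negP; rewrite -leNgt.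
  by rewrite -(subrKA r' p) (distrC q) ler_normD.
exact: far h1 h2.
Qed.

End Schwarz.

(** * Periodic sequences *)

Section Periodic.
Variable n : nat.
Hypothesis n_gt0 : (0 < n)%N.

Lemma nperiodicMz T (u : int -> T) : nperiodic n u ->
  forall i j, u (i + j * n%:Z) = u i.
Proof.
move=> up i j.
have uN (l : nat) i' : u (i' + l%:Z * n%:Z) = u i'.
  elim: l i' => [|l IH] i'; first by rewrite mul0r addr0.
  by rewrite intS mulrDl mul1r addrA IH up.
case: (intP j) => [|l|l]; first by rewrite mul0r addr0.
  exact: uN.
by rewrite -[in RHS](subrK (l.+1%:Z * n%:Z) i) uN mulNr.
Qed.

Lemma nperiodic_modz T (u : int -> T) : nperiodic n u ->
  forall i, u (i %% n%:Z)%Z = u i.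
Proof.
move=> up i; rewrite [in RHS](divz_eq i n%:Z) addrC.
by rewrite nperiodicMz.
Qed.

Lemma absz_mod_lt i : (`|(i %% n%:Z)%Z| < n)%N.
Proof.
have n0 : n%:Z != 0 by rewrite eqz_nat -lt0n.
by rewrite -ltz_nat gez0_abs ?modz_ge0 // ltz_pmod // ltz_nat.
Qed.

Lemma sum_period0 (V : zmodType) (f : int -> V) : nperiodic n f ->
  \sum_(0 <= i < n) f i%:Z = \sum_(1 <= i < n.+1) f i%:Z.
Proof.
move=> fp; rewrite big_add1 /= -(prednK n_gt0) big_nat_recl // big_nat_recr //=.
by rewrite addrC prednK // -[n%:Z in RHS]add0r fp.
Qed.

Lemma sum_period_shift (V : zmodType) (f : int -> V) : nperiodic n f ->
  \sum_(1 <= i < n.+1) f (i%:Z + 1) = \sum_(1 <= i < n.+1) f i%:Z.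
Proof.
move=> fp; rewrite [RHS]big_nat_recl // [LHS]big_nat_recr //= addrC.
have -> : n%:Z + 1 = 1 + n%:Z by rewrite addrC.
rewrite fp; congr (_ + _); apply: eq_bigr => i _.
by rewrite -addn1 PoszD.
Qed.

Lemma sum_period_diff (V : zmodType) (f : int -> V) : nperiodic n f ->
  \sum_(1 <= i < n.+1) (f (i%:Z + 1) - f i%:Z) = 0.
Proof. by move=> fp; rewrite big_split sumrN /= sum_period_shift // subrr. Qed.

(** Partial sums over one period, a periodic solution of
    [z (i + 1) - z i = d i] when [d] has zero sum. *)
Definition antidiff (V : zmodType) (d : int -> V) (i : int) : V :=
  \sum_(0 <= l < `|(i %% n%:Z)%Z|) d l%:Z.

Lemma antidiff_periodic (V : zmodType) (d : int -> V) :
  nperiodic n (antidiff d).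
Proof. by move=> i; rewrite /antidiff modzDr. Qed.

Lemma antidiffP (V : zmodType) (d : int -> V) : nperiodic n d ->
  \sum_(1 <= i < n.+1) d i%:Z = 0 ->
  forall i, antidiff d (i + 1) - antidiff d i = d i.
Proof.
move=> dp d0 i.
have ap := antidiff_periodic d.
have ap1 : nperiodic n (fun i => antidiff d (i + 1)).
  by move=> j; rewrite addrAC ap.
suff : antidiff d ((i %% n%:Z)%Z + 1) - antidiff d (i %% n%:Z)%Z = d (i %% n%:Z)%Z.
  by rewrite (nperiodic_modz ap1) (nperiodic_modz ap) (nperiodic_modz dp).
have n0 : n%:Z != 0 by rewrite eqz_nat -lt0n.
have [j [jn ->]] : exists j : nat, (j < n)%N /\ (i %% n%:Z)%Z = j%:Z.
  by exists `|(i %% n%:Z)%Z|%N; rewrite absz_mod_lt gez0_abs ?modz_ge0.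
rewrite /antidiff.
have jE : `|(j%:Z %% n%:Z)%Z|%N = j by rewrite modz_nat modn_small.
rewrite jE -PoszD addn1 modz_nat absz_nat.
move: jn; rewrite leq_eqVlt => /orP[/eqP jn|jn].
  have : \sum_(0 <= l < n) d l%:Z = 0 by rewrite sum_period0.
  rewrite -jn modnn big_nat_recr //= [X in _ -> X - _ = _]big_geq // sub0r => /eqP.
  by rewrite addr_eq0 => /eqP ->; rewrite opprK.
by rewrite modn_small // big_nat_recr //= addrAC subrr add0r.
Qed.

End Periodic.

Lemma per_ext_periodic (R : realType) m n (u : {ffun 'I_n -> 'rV[R]_m}) :
  nperiodic n (per_ext u).
Proof. by move=> i; rewrite /per_ext modzDr. Qed.

Lemma per_extP (R : realType) m n a (u v : {ffun 'I_n -> 'rV[R]_m}) i :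
  per_ext (a *: u + v) i = a *: per_ext u i + per_ext v i.
Proof.
by rewrite /per_ext; case: insub => [j|]; rewrite ?ffunE // scaler0 addr0.
Qed.

Lemma per_extD (R : realType) m n (u v : {ffun 'I_n -> 'rV[R]_m}) i :
  per_ext (u + v) i = per_ext u i + per_ext v i.
Proof. by rewrite -[u]scale1r per_extP !scale1r. Qed.

Lemma per_extB (R : realType) m n (u v : {ffun 'I_n -> 'rV[R]_m}) i :
  per_ext (u - v) i = per_ext u i - per_ext v i.
Proof. by rewrite addrC -scaleN1r per_extP scaleN1r addrC. Qed.

Lemma per_ext0 (R : realType) m n i : per_ext (0 : {ffun 'I_n -> 'rV[R]_m}) i = 0.
Proof. by rewrite -(subrr 0) per_extB subrr. Qed.

Lemma per_ext_ord (R : realType) m n (u : {ffun 'I_n -> 'rV[R]_m}) (j : 'I_n) :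
  per_ext u j = u j.
Proof. by rewrite /per_ext modz_nat modn_small // absz_nat valK. Qed.

Lemma per_ext_restrict (R : realType) m n (s : int -> 'rV[R]_m) :
  (0 < n)%N -> nperiodic n s ->
  forall i, per_ext [ffun j : 'I_n => s (j : nat)] i = s i.
Proof.
move=> n_gt0 sp i; rewrite /per_ext insubT ?absz_mod_lt // => j_lt.
rewrite ffunE /= gez0_abs ?modz_ge0 ?nperiodic_modz //.
by rewrite eqz_nat -lt0n.
Qed.

(** * The action Hessian along the periodic Jacobi fields *)

Section Variational.
Variables (R : realType) (m n k : nat) (A B : int -> 'M[R]_m).
Variable w : 'I_k -> int -> 'rV[R]_m.
Hypotheses (n_gt0 : (0 < n)%N) (B_per : nperiodic n B).
Hypotheses (A_sym : forall i, (A i)^T = A i).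
Hypotheses (w_per : forall a, nperiodic n (w a)).
Hypotheses (w_traj : forall a, var_trajectory A B (w a)).
Hypotheses (G_sym : forall i, (Gmx B w i)^T = Gmx B w i).
Hypotheses (G_unit : forall i, Gmx B w i \in unitmx).

Local Notation E := 'rV[R]_m.
Local Notation X := {ffun 'I_n -> 'rV[R]_m}.
Local Notation G := (Gmx B w).

(** The values at [i] of the fields [w a], as the rows of a matrix. *)
Definition wmx i : 'M[R]_(k, m) := \matrix_a w a i.

Lemma GmxE i : G i = wmx i *m B i *m (wmx (i + 1))^T.
Proof.
apply/matrixP => a b; rewrite mxE /pairing.
by rewrite !mxE; apply: eq_bigr => j _; rewrite !mxE; congr (_ * _);
  apply: eq_bigr => l _; rewrite !mxE.
Qed.

Lemma wmx_per : nperiodic n wmx.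
Proof. by move=> i; apply/matrixP => a j; rewrite !mxE w_per. Qed.

Lemma Gmx_per : nperiodic n G.
Proof. by move=> i; rewrite !GmxE addrAC !wmx_per B_per. Qed.

Lemma wmx_traj i :
  wmx i *m A i = wmx (i - 1) *m B (i - 1) + wmx (i + 1) *m (B i)^T.
Proof.
apply/row_matrixP => a; rewrite linearD /= !row_mul !rowK.
by apply/eqP; rewrite -subr_eq0 opprD addrA; apply/eqP/w_traj.
Qed.

(** The action Hessian as a form on all sequences.  It is symmetric on the
    periodic ones. *)
Definition hess_seq (u v : int -> E) : R :=
  \sum_(1 <= i < n.+1) pairing (var_op A B u i%:Z) (v i%:Z).

Local Notation pbil := (@pairing_bilinear R _).

Lemma hess_seqC u v : nperiodic n u -> nperiodic n v ->
  hess_seq u v = hess_seq v u.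
Proof.
move=> up vp.
have hE u' v' : nperiodic n u' -> nperiodic n v' -> hess_seq u' v' =
    \sum_(1 <= i < n.+1) pairing (u' i%:Z *m A i%:Z) (v' i%:Z)
    - \sum_(1 <= i < n.+1) pairing (u' i%:Z *m B i%:Z) (v' (i%:Z + 1))
    - \sum_(1 <= i < n.+1) pairing (v' i%:Z *m B i%:Z) (u' (i%:Z + 1)).
  move=> up' vp'.
  pose f i := pairing (u' (i - 1) *m B (i - 1)) (v' i).
  have fp : nperiodic n f by move=> i; rewrite /f addrAC up' B_per vp'.
  have -> : \sum_(1 <= i < n.+1) pairing (u' i%:Z *m B i%:Z) (v' (i%:Z + 1)) =
            \sum_(1 <= i < n.+1) f i%:Z.
    by rewrite -(sum_period_shift n_gt0 fp); apply: eq_bigr => i _; rewrite /f addrK.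
  rewrite -!sumrB; apply: eq_bigr => i _.
  rewrite /var_op !(sbBl pbil) /f; congr (_ - _).
  by rewrite pairing_mulmx trmxK pairingC.
rewrite !hE // addrAC; congr (_ - _ - _); apply: eq_bigr => i _.
by rewrite pairing_mulmx A_sym pairingC.
Qed.

Lemma hess_seqPl a u1 u2 v :
  hess_seq (fun i => a *: u1 i + u2 i) v = a * hess_seq u1 v + hess_seq u2 v.
Proof.
rewrite /hess_seq mulr_sumr -big_split; apply: eq_bigr => i _ /=.
rewrite -pairingPl; congr pairing; rewrite /var_op.
rewrite !mulmxDl -!scalemxAl !scalerBr; apply/rowP => j; rewrite !mxE; ring.
Qed.

Lemma action_hessian_bilinear : sym_bilinear (action_hessian n A B).
Proof.
split=> [u v|a u v z]; first by apply: hess_seqC; apply: per_ext_periodic.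
rewrite /action_hessian -!/(hess_seq _ _) -hess_seqPl.
by rewrite /hess_seq; apply: eq_bigr => i _; rewrite /var_op !per_extP.
Qed.

(** The row vector of the pairings [<B_i u_i, w_{i+1}^a>], the quantities that
    enter the reduced form. *)
Definition bform (u : int -> E) (i : int) : 'rV[R]_k :=
  u i *m B i *m (wmx (i + 1))^T.

(** The row vector of the pairings [<B_{i-1} w_{i-1}^a, u_i>]; their vanishing
    for all [i] defines the reduced space.  The entries of
    [bform' u (i + 1) - bform u i] are the symplectic products of the [w^a] with
    [u] at time [i]. *)
Definition bform' (u : int -> E) (i : int) : 'rV[R]_k :=
  u i *m (B (i - 1))^T *m (wmx (i - 1))^T.

Lemma bformE u i a : bform u i 0 a = pairing (u i *m B i) (w a (i + 1)).
Proof. by rewrite /pairing /bform !mxE; apply: eq_bigr => j _; rewrite !mxE. Qed.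

Lemma bform'E u i a :
  bform' u i 0 a = pairing (w a (i - 1) *m B (i - 1)) (u i).
Proof.
rewrite pairingC -{1}[B (i - 1)]trmxK -pairing_mulmx /bform' /pairing !mxE.
by apply: eq_bigr => j _; rewrite !mxE.
Qed.

Lemma bform_per u : nperiodic n u -> nperiodic n (bform u).
Proof. by move=> up i; rewrite /bform addrAC up B_per wmx_per. Qed.

Lemma bform'_per u : nperiodic n u -> nperiodic n (bform' u).
Proof. by move=> up i; rewrite /bform' addrAC up B_per wmx_per. Qed.

(** The sequence with coordinates [z i] in the basis [w^a_i]. *)
Definition spanseq (z : int -> 'rV[R]_k) i : E := z i *m wmx i.

Lemma spanseq_per z : nperiodic n z -> nperiodic n (spanseq z).
Proof. by move=> zp i; rewrite /spanseq zp wmx_per. Qed.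

Lemma bform_span z i : bform (spanseq z) i = z i *m G i.
Proof. by rewrite GmxE /bform /spanseq !mulmxA. Qed.

Lemma bform'_span z i : bform' (spanseq z) i = z i *m G (i - 1).
Proof.
by rewrite -G_sym GmxE subrK /bform' /spanseq !trmx_mul trmxK !mulmxA.
Qed.

Lemma var_op_span z i : var_op A B (spanseq z) i =
  (z i - z (i - 1)) *m wmx (i - 1) *m B (i - 1)
  - (z (i + 1) - z i) *m wmx (i + 1) *m (B i)^T.
Proof.
rewrite /var_op /spanseq -mulmxA wmx_traj mulmxDr !mulmxA !mulmxBl.
apply/rowP => j; rewrite !mxE; ring.
Qed.

Lemma var_op_span_pairing z v i : pairing (var_op A B (spanseq z) i) (v i) =
  pairing (z i - z (i - 1)) (bform' v i) - pairing (z (i + 1) - z i) (bform v i).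
Proof.
rewrite var_op_span (sbBl pbil) !pairing_mulmx trmxK.
by [].
Qed.

(** Variation of constants: only the increments of [z] enter, since the
    [w^a] are trajectories. *)
Lemma hess_span z v : nperiodic n z -> nperiodic n v ->
  hess_seq (spanseq z) v =
  \sum_(1 <= i < n.+1) pairing (z (i%:Z + 1) - z i%:Z)
     (bform' v (i%:Z + 1) - bform v i%:Z).
Proof.
move=> zp vp; rewrite /hess_seq.
under eq_bigr do rewrite var_op_span_pairing.
pose f i := pairing (z i - z (i - 1)) (bform' v i).
have fp : nperiodic n f by move=> i; rewrite /f addrAC !zp bform'_per.
rewrite sumrB -(sum_period_shift n_gt0 fp) -sumrB; apply: eq_bigr => i _.
by rewrite /f addrK -(sbBr pbil).
Qed.


(** * The splitting of the space of periodic sequences *)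

(** Pointwise linear conditions on the periodic extension of a vector, with
    periodic coefficients, cut out a subspace. *)
Lemma periodic_kernel p (C : int -> 'M[R]_(m, p)) : nperiodic n C ->
  exists U : {vspace X}, forall v,
    (v \in U) <-> (forall i, per_ext v i *m C i = 0).
Proof.
move=> Cp; pose F (v : X) : {ffun 'I_n -> 'rV[R]_p} :=
  [ffun j : 'I_n => per_ext v (j : nat) *m C (j : nat)].
have F_lin : linear F.
  by move=> a u v; apply/ffunP => j; rewrite !ffunE per_extP mulmxDl scalemxAl.
exists (lker (linfun F)) => v; rewrite memv_ker linfun_funE //.
have FE i : per_ext (F v) i = per_ext v i *m C i.
  apply: (per_ext_restrict (s := fun i => per_ext v i *m C i)) => // j.
  by rewrite per_ext_periodic Cp.
split=> [/eqP Fv0 i|v0]; first by rewrite -FE Fv0 per_ext0.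
by apply/eqP/ffunP => j; rewrite -per_ext_ord FE v0 ffunE.
Qed.

(** Projection of [E_i] onto the annihilator of the [B_{i-1} w_{i-1}], along
    the span of the [w_i]. *)
Definition projmx i : 'M[R]_m :=
  1%:M - (B (i - 1))^T *m (wmx (i - 1))^T *m invmx (G (i - 1)) *m wmx i.

(** The coordinates of the span component for that splitting of [E_i]. *)
Definition coordseq (u : int -> E) i : 'rV[R]_k :=
  bform' u i *m invmx (G (i - 1)).

Lemma projmx_per : nperiodic n projmx.
Proof.
by move=> i; rewrite /projmx addrAC B_per !wmx_per Gmx_per.
Qed.

Lemma mul_projmx u i : u i *m projmx i = u i - spanseq (coordseq u) i.
Proof. by rewrite mulmxBr mulmx1 !mulmxA. Qed.

Lemma coordseq_span z i : coordseq (spanseq z) i = z i.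
Proof. by rewrite /coordseq bform'_span mulmxK. Qed.

Lemma wmx_projmx i : wmx i *m projmx i = 0.
Proof.
apply/row_matrixP => a; rewrite row_mul row0 rowE.
apply: etrans (mul_projmx (spanseq (fun=> delta_mx 0 a)) i) _.
by rewrite {2}/spanseq coordseq_span subrr.
Qed.

Lemma bform'_proj u i : bform' (fun j => u j *m projmx j) i = 0.
Proof.
rewrite /bform' mul_projmx 2!mulmxBl -!/(bform' _ i).
by rewrite bform'_span mulmxKV // subrr.
Qed.

Lemma coordseq_per u : nperiodic n u -> nperiodic n (coordseq u).
Proof. by move=> up i; rewrite /coordseq bform'_per // addrAC Gmx_per. Qed.

Lemma mem_span_wmx i (x : E) :
  (x \in <<[seq w a i | a <- enum 'I_k]>>%VS) = (x *m projmx i == 0).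
Proof.
apply/idP/eqP => [xw|x0].
  have mul_lin : linear (mulmx^~ (projmx i) : E -> E).
    by move=> a u v; rewrite mulmxDl scalemxAl.
  have : (<<[seq w a i | a <- enum 'I_k]>>
          <= lker (linfun (mulmx^~ (projmx i) : E -> E)))%VS.
    apply/span_subvP => _ /mapP[a _ ->]; rewrite memv_ker linfun_funE //.
    by rewrite -(rowK (w^~ i) a) -row_mul wmx_projmx row0.
  by move=> /subvP/(_ x xw); rewrite memv_ker linfun_funE // => /eqP.
move/eqP: x0; rewrite (mul_projmx (fun=> x)) subr_eq0 => /eqP ->.
rewrite /spanseq mulmx_sum_row; apply: memv_suml => a _.
by rewrite memvZ // rowK memv_span // map_f // mem_enum.
Qed.

Lemma Zspace_vspace : exists Z : {vspace X}, Zspace n w = [set v | v \in Z] /\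
  (forall v, v \in Z <-> (forall i, per_ext v i *m projmx i = 0)).
Proof.
have [Z ZE] := periodic_kernel projmx_per; exists Z; split=> //.
apply/seteqP; split=> v /=.
  by move=> vZ; apply/ZE => i; apply/eqP; rewrite -mem_span_wmx; apply: vZ.
by move=> /ZE vZ i; rewrite mem_span_wmx vZ.
Qed.

Lemma Xperp_vspace : exists Y : {vspace X}, Xperp n B w = [set v | v \in Y] /\
  (forall v, v \in Y <-> (forall i, bform' (per_ext v) i = 0)).
Proof.
have Cper : nperiodic n (fun i => (B (i - 1))^T *m (wmx (i - 1))^T).
  by move=> i; rewrite addrAC B_per wmx_per.
have [Y YE] := periodic_kernel Cper.
have YE' v : v \in Y <-> (forall i, bform' (per_ext v) i = 0).
  split=> [/YE v0 i|v0]; first by rewrite /bform' -mulmxA.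
  by apply/YE => i; rewrite mulmxA; apply: v0.
exists Y; split=> //; apply/seteqP; split=> v /=.
  by move=> vY; apply/YE' => i; apply/rowP => a; rewrite bform'E vY mxE.
by move=> /YE' vY i a; rewrite -bform'E vY mxE.
Qed.

(** * The reduced form and the correction by a span sequence *)

Local Notation Gb := (Gbar n B w).

(** On the orthogonal complement of the span sequences, [h] is the sum of the
    reduced form and of the form [Gbar^-1] evaluated on these [k] linear forms. *)
Definition cseq (u : int -> E) : 'rV[R]_k :=
  \sum_(1 <= i < n.+1) bform u i%:Z *m invmx (G i%:Z).

Lemma Gbar_sym : Gb^T = Gb.
Proof.
by rewrite /Gbar raddf_sum; apply: eq_bigr => i _; rewrite /= trmx_inv G_sym.
Qed.

Lemma bformP a u v i :
  bform (fun i => a *: u i + v i) i = a *: bform u i + bform v i.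
Proof. by rewrite /bform !mulmxDl !scalemxAl. Qed.

Lemma cseqP a u v : cseq (fun i => a *: u i + v i) = a *: cseq u + cseq v.
Proof.
rewrite /cseq scaler_sumr -big_split; apply: eq_bigr => i _ /=.
by rewrite bformP mulmxDl scalemxAl.
Qed.

(** The reduced action form, on all sequences. *)
Definition perp_seq (u v : int -> E) : R := hess_seq u v -
  \sum_(1 <= i < n.+1) pairing (bform u i%:Z *m invmx (G i%:Z)) (bform v i%:Z).

Lemma hessian_perpE (u v : X) :
  hessian_perp n A B w u v = perp_seq (per_ext u) (per_ext v).
Proof.
rewrite /hessian_perp /perp_seq; congr (_ - _); apply: eq_bigr => i _.
rewrite [RHS]/pairing [RHS]mxE exchange_big /=; apply: eq_bigr => b _.
rewrite [in RHS]mxE mulr_suml [in RHS]mxE; apply: eq_bigr => a _.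
by rewrite !bformE; congr (_ * _); rewrite mulrC.
Qed.

Lemma hessian_perp_bilinear : sym_bilinear (hessian_perp n A B w).
Proof.
split=> [u v|a u v z]; rewrite !hessian_perpE /perp_seq.
  rewrite hess_seqC; [|exact: per_ext_periodic..]; congr (_ - _).
  apply: eq_bigr => i _.
  by rewrite pairing_mulmx trmx_inv G_sym pairingC.
rewrite (_ : per_ext (a *: u + v) = fun i => a *: per_ext u i + per_ext v i);
  last by apply/funext => i; rewrite per_extP.
rewrite hess_seqPl mulrBr addrACA -opprD; congr (_ - _).
rewrite mulr_sumr -big_split; apply: eq_bigr => i _ /=.
by rewrite bformP mulmxDl -scalemxAl pairingPl.
Qed.

Hypothesis Gb_unit : Gb \in unitmx.
Local Notation K := (invmx Gb).

(** The coordinates of a span sequence that makes [u] orthogonal to all span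
    sequences, for [u] in the reduced space.  Its increments must equal
    [(bform u i + t) G_i^-1] with [t] independent of [i], and [t] is determined
    by the requirement that they sum to zero over a period. *)
Definition corr (u : int -> E) : int -> 'rV[R]_k :=
  antidiff n (fun i => (bform u i - cseq u *m K) *m invmx (G i)).

Lemma corr_per u : nperiodic n (corr u).
Proof. exact: antidiff_periodic. Qed.

Lemma corr_diff u i : nperiodic n u ->
  corr u (i + 1) - corr u i = (bform u i - cseq u *m K) *m invmx (G i).
Proof.
move=> up; apply: (antidiffP n_gt0) => [j|].
  by rewrite bform_per // Gmx_per.
under eq_bigr do rewrite mulmxBl.
by rewrite sumrB -mulmx_sumr -/(cseq u) mulmxKV // subrr.
Qed.

Lemma corrP a u v i :
  corr (fun i => a *: u i + v i) i = a *: corr u i + corr v i.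
Proof.
rewrite /corr /antidiff scaler_sumr -big_split; apply: eq_bigr => l _ /=.
rewrite bformP cseqP [a *: (_ *m invmx _)]scalemxAl -mulmxDl; congr (_ *m _).
by rewrite mulmxDl -scalemxAl scalerBr opprD addrACA.
Qed.

(** The corrected sequence. *)
Definition Tseq (u : int -> E) i := u i + spanseq (corr u) i.

Lemma Tseq_per u : nperiodic n u -> nperiodic n (Tseq u).
Proof. by move=> up i; rewrite /Tseq up spanseq_per //; apply: corr_per. Qed.

Lemma hess_span_Tseq z u : nperiodic n z -> nperiodic n u ->
  (forall i, bform' u i = 0) -> hess_seq (spanseq z) (Tseq u) = 0.
Proof.
move=> zp up u0; rewrite hess_span //; last exact: Tseq_per.
have E1 i : bform' (Tseq u) (i + 1) - bform (Tseq u) i = - (cseq u *m K).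
  have -> : bform' (Tseq u) (i + 1) = corr u (i + 1) *m G i.
    rewrite -[G i](congr1 G (addrK 1 i)) -bform'_span -[RHS]add0r -(u0 (i + 1)).
    by rewrite /bform' -!mulmxDl.
  have -> : bform (Tseq u) i = bform u i + corr u i *m G i.
    by rewrite -bform_span /bform -!mulmxDl.
  rewrite opprD addrCA -mulmxBl corr_diff // mulmxKV //.
  by rewrite addrA [- _ + _]addrC subrr sub0r.
under eq_bigr do rewrite E1.
by rewrite pairing_suml sum_period_diff // (sb0l pbil).
Qed.

Lemma hess_Tseq u : nperiodic n u -> (forall i, bform' u i = 0) ->
  hess_seq (Tseq u) (Tseq u) = perp_seq u u + mx_form K (cseq u) (cseq u).
Proof.
move=> up u0.
have hD u1 u2 v : hess_seq (fun i => u1 i + u2 i) v = hess_seq u1 v + hess_seq u2 v.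
  rewrite -[hess_seq u1 v]mul1r -hess_seqPl; congr hess_seq.
  by apply/funext => i; rewrite scale1r.
rewrite {1}/Tseq hD hess_span_Tseq //; last exact: corr_per.
rewrite addr0 hess_seqC //; last exact: Tseq_per.
rewrite /Tseq hD hess_span //; last exact: corr_per.
rewrite /perp_seq -addrA; congr (_ + _).
under eq_bigr do rewrite corr_diff // u0 sub0r -[- bform _ _]scaleN1r (sbZr pbil)
  mulN1r mulmxBl (sbBl pbil) opprB.
rewrite sumrB addrC; congr (_ + _).
under eq_bigr do rewrite pairing_mulmx trmx_inv G_sym.
by rewrite pairing_sumr.
Qed.

(** [Tseq] on the vector space of periodic sequences. *)
Definition Tmap (v : X) : X :=
  v + [ffun j : 'I_n => spanseq (corr (per_ext v)) (j : nat)].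

Lemma Tmap_linear : linear Tmap.
Proof.
move=> a u v; rewrite /Tmap scalerDr addrACA; congr (_ + _).
apply/ffunP => j; rewrite !ffunE /spanseq scalemxAl -mulmxDl -corrP.
by congr (corr _ _ *m _); apply/funext => i; rewrite per_extP.
Qed.

Lemma per_ext_Tmap v : per_ext (Tmap v) = Tseq (per_ext v).
Proof.
apply/funext => i; rewrite per_extD per_ext_restrict //.
by apply: spanseq_per; apply: corr_per.
Qed.

(** * The trajectories of the generalized eigenvectors *)

(** Conservation of the symplectic product of the [w^a] with a trajectory. *)
Lemma bform_conserved u i : var_op A B u i = 0 ->
  bform' u (i + 1) - bform u i = bform' u i - bform u (i - 1).
Proof.
move=> /eqP; rewrite /var_op subr_eq0 => /eqP uE.
have WA : A i *m (wmx i)^T = (B (i - 1))^T *m (wmx (i - 1))^T + B i *m (wmx (i + 1))^T.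
  by rewrite -[A i]A_sym -trmx_mul wmx_traj linearD /= !trmx_mul trmxK.
rewrite /bform /bform' addrK -uE subrK mulmxBl -(mulmxA (u i) (A i)) WA mulmxDr !mulmxA.
by rewrite addrAC addrK.
Qed.

(* [U t] is the trajectory of the combination of the generalized eigenvectors
   with coefficients [t].  It is only used on the indices from 0 to n + 1. *)
Variables (S : 'M[R]_k) (U : 'rV[R]_k -> int -> E).
Hypotheses (U_lin : forall a t t' i, U (a *: t + t') i = a *: U t i + U t' i).
Hypotheses (U_traj : forall t i, (0 < i <= n)%N -> var_op A B (U t) i%:Z = 0).
Hypotheses (U_n : forall t, U t n%:Z = U t 0 + t *m S *m wmx 0).
Hypotheses (U_n1 : forall t, U t (n%:Z + 1) = U t 1 + t *m S *m wmx 1).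
Hypotheses (U_symp : forall t, bform' (U t) 1 - bform (U t) 0 = t).

Lemma U_sympj t (i : nat) : (i <= n)%N ->
  bform' (U t) (i%:Z + 1) - bform (U t) i%:Z = t.
Proof.
elim: i => [|i IH] i_n; first by rewrite add0r U_symp.
have iE : i.+1%:Z - 1 = i%:Z by rewrite -addn1 PoszD addrK.
rewrite bform_conserved ?U_traj // iE -[i.+1%:Z](subrK 1) iE.
by apply: IH; apply: ltnW.
Qed.

(** The component of [U t] in the reduced space: on the indices from 0 to
    n + 1 it is periodic, since [U t] changes by a span element over a period. *)
Let Uproj t i := U t i *m projmx i.

Lemma coord_diff t (i : nat) : (i <= n)%N ->
  coordseq (U t) (i%:Z + 1) - coordseq (U t) i%:Z =
  (t + bform (Uproj t) i%:Z) *m invmx (G i%:Z).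
Proof.
move=> i_n; apply: (can_inj (mulmxK (G_unit i%:Z))).
rewrite mulmxKV // mulmxBl {1}/coordseq addrK mulmxKV //.
have -> : bform (Uproj t) i%:Z = bform (U t) i%:Z - coordseq (U t) i%:Z *m G i%:Z.
  by rewrite -bform_span /bform /Uproj mul_projmx 2!mulmxBl.
rewrite addrA; congr (_ - _).
by apply/eqP; rewrite -subr_eq; apply/eqP/U_sympj.
Qed.

(** [Uproj t] as an element of the space of periodic sequences; it represents
    the linear form [v |-> pairing t (cseq v)] in the reduced form. *)
Definition ymap t : X := [ffun j : 'I_n => Uproj t (j : nat)].

Lemma ymap_linear : linear ymap.
Proof.
move=> a t t'; apply/ffunP => j.
by rewrite !ffunE /Uproj U_lin mulmxDl scalemxAl.
Qed.

Lemma per_ext_ymap t (i : nat) : (i <= n.+1)%N ->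
  per_ext (ymap t) i%:Z = Uproj t i%:Z.
Proof.
have lt_n j : (j < n)%N -> per_ext (ymap t) j%:Z = Uproj t j%:Z.
  by move=> jn; rewrite -[j]/(nat_of_ord (Ordinal jn)) per_ext_ord ffunE.
have le_n j : (j <= n)%N -> per_ext (ymap t) j%:Z = Uproj t j%:Z.
  rewrite leq_eqVlt => /orP[/eqP ->|]; last exact: lt_n.
  rewrite -[n%:Z]add0r per_ext_periodic lt_n // /Uproj projmx_per add0r U_n.
  by rewrite mulmxDl -mulmxA wmx_projmx mulmx0 addr0.
rewrite leq_eqVlt => /orP[/eqP ->|]; last exact: le_n.
have -> : n.+1%:Z = 1%:Z + n%:Z by lia.
rewrite per_ext_periodic le_n // /Uproj projmx_per [1%:Z + _]addrC U_n1.
by rewrite mulmxDl -mulmxA wmx_projmx mulmx0 addr0.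
Qed.

Lemma ymap_perp t i : bform' (per_ext (ymap t)) i = 0.
Proof.
have yp := @per_ext_periodic R m n (ymap t).
rewrite -(nperiodic_modz (bform'_per yp)).
have [j [jn ->]] : exists j : nat, (j < n)%N /\ (i %% n%:Z)%Z = j%:Z.
  exists `|(i %% n%:Z)%Z|%N; rewrite absz_mod_lt // gez0_abs // modz_ge0 //.
  by rewrite eqz_nat -lt0n.
by rewrite /bform' per_ext_ymap; [exact: bform'_proj|lia].
Qed.

Lemma bform_ymap t (i : nat) : (i <= n)%N ->
  bform (per_ext (ymap t)) i%:Z = bform (Uproj t) i%:Z.
Proof. by move=> i_n; rewrite /bform per_ext_ymap // leqW. Qed.

Lemma cseq_ymap t : cseq (per_ext (ymap t)) = t *m (S - Gb).
Proof.
rewrite /cseq mulmxBr /Gbar mulmx_sumr.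
have -> : t *m S = coordseq (U t) n.+1%:Z - coordseq (U t) 1.
  have -> : n.+1%:Z = n%:Z + 1 by lia.
  have G_n : G n%:Z = G 0 by rewrite -[n%:Z]add0r Gmx_per.
  have bU : bform' (U t) (n%:Z + 1) =
      bform' (U t) 1 + bform' (spanseq (fun=> t *m S)) 1.
    rewrite /bform' addrK subrr U_n1 -[n%:Z]add0r B_per wmx_per.
    by rewrite -!mulmxDl.
  rewrite /coordseq addrK subrr G_n -mulmxBl bU [bform' _ 1 + _]addrC addrK.
  by rewrite bform'_span subrr mulmxK.
rewrite -(telescope_sumr (fun i : nat => coordseq (U t) i%:Z)) // -sumrB.
apply: eq_big_nat => i /andP[_ i_n].
have -> : i.+1%:Z = i%:Z + 1 by lia.
by rewrite coord_diff // bform_ymap // mulmxDl addrC addKr.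
Qed.

Lemma perp_ymap t v : nperiodic n v -> (forall i, bform' v i = 0) ->
  perp_seq (per_ext (ymap t)) v = pairing t (cseq v).
Proof.
move=> vp v0; rewrite /perp_seq /hess_seq -sumrB /cseq -pairing_sumr.
apply: eq_big_nat => i /andP[i0 i_n]; rewrite ltnS in i_n.
have -> : var_op A B (per_ext (ymap t)) i%:Z =
    - var_op A B (spanseq (coordseq (U t))) i%:Z.
  have i1 : i%:Z - 1 = i.-1%:Z by lia.
  have i2 : i%:Z + 1 = i.+1%:Z by lia.
  have := U_traj t; move=> /(_ i); rewrite i0 i_n => /(_ isT).
  move/eqP; rewrite -subr_eq0 => /eqP UE.
  rewrite -[RHS]addr0 -UE subr0 /var_op i1 i2 !per_ext_ymap; [|lia..].
  rewrite /Uproj !mul_projmx !mulmxBl; apply/rowP => j; rewrite !mxE; ring.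
rewrite -scaleN1r (sbZl pbil) mulN1r var_op_span_pairing v0 (sb0r pbil) sub0r opprK.
rewrite coord_diff // bform_ymap // -(sbBl pbil) -mulmxBl addrK.
by rewrite pairing_mulmx trmx_inv G_sym.
Qed.

Hypothesis Aperp_unit : S - Gb \in unitmx.

(** The identity of the indices, written without subtraction. *)
Lemma index_identity :
  (neg_index (action_hessian n A B) [set: X] + mx_neg_index (Amx_perp n B w S) =
   neg_index (action_hessian n A B) (Zspace n w) +
   neg_index (hessian_perp n A B w) (Xperp n B w) + mx_neg_index (Amx n B w S))%N.
Proof.
have [Z [-> ZE]] := Zspace_vspace; have [Y [-> YE]] := Xperp_vspace.
have KT : K^T = K by rewrite trmx_inv Gbar_sym.
have c_lin : linear (fun v : X => cseq (per_ext v)).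
  move=> a u v; rewrite -cseqP; congr cseq; apply/funext => i.
  by rewrite per_extP.
have perp v := @per_ext_periodic R m n v.
pose c : 'Hom(X, 'rV[R]_k) := linfun (fun v : X => cseq (per_ext v)).
have cE v : c v = cseq (per_ext v) by apply: linfun_funE.
have TE v : linfun Tmap v = Tmap v by apply: linfun_funE; apply: Tmap_linear.
have yE t : linfun ymap t = ymap t by apply: linfun_funE; apply: ymap_linear.
pose b' u v := hessian_perp n A B w u v + mx_form K (c u) (c v).
have KP := mx_form_bilinear KT.
have b'P : sym_bilinear b'.
  split=> [u v|a u v z]; rewrite /b'.
    by rewrite (sbC hessian_perp_bilinear) (sbC KP).
  rewrite linearP (sbPl hessian_perp_bilinear) (sbPl KP); ring.
have spanZ (v : X) z : (forall i, per_ext v i = spanseq z i) -> v \in Z.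
  by move=> vE; apply/ZE => i; rewrite vE /spanseq -mulmxA wmx_projmx mulmx0.
have ZY : (Z + Y)%VS = fullv.
  apply/eqP; rewrite eqEsubv subvf; apply/subvP => v _.
  pose z : X := [ffun j : 'I_n => spanseq (coordseq (per_ext v)) (j : nat)].
  have zE i : per_ext z i = spanseq (coordseq (per_ext v)) i.
    by rewrite per_ext_restrict //; apply/spanseq_per/coordseq_per/perp.
  rewrite -[v](subrKC z) memv_add ?(spanZ _ _ zE) //.
  apply/YE => i; rewrite -(bform'_proj (per_ext v) i); congr bform'.
  by apply/funext => j; rewrite mul_projmx per_extB zE.
rewrite (@neg_index_reduction _ _ _ b' Z Y (linfun Tmap)) //.
- rewrite -!addnA; congr (_ + _)%N.
  rewrite [LHS](@neg_index_perturbation _ _ _ _ _ c (linfun ymap) K (S - Gb)) //.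
  + rewrite /Amx; congr (_ + mx_neg_index _)%N.
    rewrite mulmxBl mulmxV // mulmxBr !mulmxBl !mul1mx mulmxKV //.
    by rewrite subrK.
  + exact: hessian_perp_bilinear.
  + by move=> t; rewrite yE; apply/YE; apply: ymap_perp.
  + by move=> t v /YE v0; rewrite yE cE hessian_perpE perp_ymap.
  + by move=> t; rewrite yE cE cseq_ymap.
- exact: action_hessian_bilinear.
- move=> v _; rewrite TE; apply: (spanZ _ (corr (per_ext v))) => i.
  by rewrite /Tmap addrAC subrr add0r per_ext_restrict //; apply/spanseq_per/corr_per.
- move=> z v /ZE z0 /YE v0; rewrite TE /action_hessian per_ext_Tmap.
  rewrite (_ : per_ext z = spanseq (coordseq (per_ext z))).
    by apply: hess_span_Tseq => //; apply/coordseq_per/perp.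
  by apply/funext => i; apply/eqP; rewrite -subr_eq0 -mul_projmx z0.
- move=> v /YE v0; rewrite TE /b' cE hessian_perpE /action_hessian per_ext_Tmap.
  by rewrite -hess_Tseq.
Qed.

End Variational.

(** * The linearized discrete Lagrangian system *)

Lemma open_setX (T1 T2 : topologicalType) (C1 : set T1) (C2 : set T2) :
  open C1 -> open C2 -> open (C1 `*` C2).
Proof.
rewrite !openE => C1o C2o z [z1 z2]; exists (C1, C2) => //.
by split; [apply: C1o|apply: C2o].
Qed.

Section Linearization.
Variables (R : realType) (m : nat) (M : topologicalType) (Mstr : manifold R m M).
Variables (L : M -> M -> R) (phi : int -> chart R m M) (x : int -> M).
Hypotheses (L_C2 : C2_lagrangian Mstr L) (phi_atlas : forall i, atlas Mstr (phi i)).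
Hypothesis phi_x : forall i, chart_dom (phi i) (x i).

Lemma coord_derive_commute i (u v : 'rV[R]_m * 'rV[R]_m) :
  let f := coord_lagrangian L (phi i) (phi (i + 1)) in
  let p := (to_coord (phi i) (x i), to_coord (phi (i + 1)) (x (i + 1))) in
  'D_u (fun z => 'D_v f z) p = 'D_v (fun z => 'D_u f z) p.
Proof.
move=> f p.
have Uo : open (chart_cod (phi i) `*` chart_cod (phi (i + 1))).
  by apply: open_setX; apply: chart_cod_open.
apply: (derive_commute Uo (L_C2 (phi_atlas i) (phi_atlas (i + 1)))).
by split; apply: to_coord_cod.
Qed.

Lemma varA_sym i : (varA L phi x i)^T = varA L phi x i.
Proof.
rewrite /varA linearD /=; congr (_ + _); apply/matrixP => a b; rewrite !mxE.
  exact: coord_derive_commute.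
exact: coord_derive_commute.
Qed.

Lemma varB_periodic n : nperiodic n x -> nperiodic n phi ->
  nperiodic n (varB L phi x).
Proof.
move=> xp phip i; rewrite /varB; congr (- _).
by apply/matrixP => a b; rewrite !mxE (addrAC i) !phip !xp.
Qed.

End Linearization.

Section Flow.
Variables (R : realType) (m n k : nat) (A B : int -> 'M[R]_m).
Variable w : 'I_k -> int -> 'rV[R]_m.
Local Notation W := ('rV[R]_m * 'rV[R]_m)%type.

Lemma poincareE (p : W) : poincare n A B p = var_flow A B n p.
Proof. by apply: linfun_funE; apply: var_flow_linear. Qed.

(** The forward trajectory with initial value [p]; its values at negative
    indices are irrelevant. *)
Definition flow_seq (p : W) (i : int) : 'rV[R]_m := (var_flow A B `|i|%N p).1.

Lemma flow_seqP a p q i :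
  flow_seq (a *: p + q) i = a *: flow_seq p i + flow_seq q i.
Proof. by rewrite /flow_seq var_flow_linear. Qed.

Lemma flow_seq_pair p (j : nat) :
  var_flow A B j p = (flow_seq p j%:Z, flow_seq p (j%:Z + 1)).
Proof.
have -> : j%:Z + 1 = j.+1%:Z by lia.
by rewrite /flow_seq /=; case: (var_flow A B j p).
Qed.

Lemma flow_seq_traj p (i : nat) : (forall i, B i \in unitmx) -> (0 < i)%N ->
  var_op A B (flow_seq p) i%:Z = 0.
Proof.
move=> Bu; case: i => // i _.
have i1 : i.+1%:Z - 1 = i%:Z by lia.
have i2 : i.+1%:Z + 1 = i.+2%:Z by lia.
rewrite /var_op i1 i2 /flow_seq /= i1 mulmxKV ?unitmx_tr //.
by apply/eqP; rewrite subr_eq0.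
Qed.

(** The antisymmetric part of [G_i] is the matrix of the symplectic products of
    the [w^a], which do not depend on [i]. *)
Lemma Gmx_sym : (0 < n)%N -> nperiodic n B -> (forall a, nperiodic n (w a)) ->
  (forall i, (A i)^T = A i) -> (forall a, var_trajectory A B (w a)) ->
  (forall a b, symp B (w a 0, w a 1) (w b 0, w b 1) = 0) ->
  forall i, (Gmx B w i)^T = Gmx B w i.
Proof.
move=> n_gt0 Bp wp A_sym w_traj w0 i.
have Gp := Gmx_per Bp wp.
rewrite -(nperiodic_modz Gp).
have [j ->] : exists j : nat, (i %% n%:Z)%Z = j%:Z.
  exists `|(i %% n%:Z)%Z|%N; rewrite gez0_abs // modz_ge0 //.
  by rewrite eqz_nat -lt0n.
have bE a b l : (bform' B w (w a) (l + 1) - bform B w (w a) l) 0 b =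
    Gmx B w l b a - Gmx B w l a b.
  have -> (u v : 'rV[R]_k) : (u - v) 0 b = u 0 b - v 0 b by rewrite !mxE.
  by rewrite bform'E bformE addrK !mxE.
apply/matrixP => a b; rewrite mxE; apply/eqP; rewrite -subr_eq0 -bE.
suff -> : bform' B w (w a) (j%:Z + 1) - bform B w (w a) j%:Z = 0 by rewrite mxE.
elim: j => [|j IH].
  apply/rowP => c; rewrite bE !mxE add0r.
  by have := w0 c a; rewrite /symp /=.
have j1 : j.+1%:Z - 1 = j%:Z by lia.
rewrite (bform_conserved A_sym w_traj (w_traj a _)).
by rewrite j1 -[j.+1%:Z](subrK 1) j1.
Qed.

Lemma wmx_pair (s : 'rV[R]_k) :
  \sum_b s 0 b *: ((w b 0, w b 1) : W) = (s *m wmx w 0, s *m wmx w 1).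
Proof.
have wi i : s *m wmx w i = \sum_b s 0 b *: w b i.
  by rewrite mulmx_sum_row; apply: eq_bigr => b _; rewrite rowK.
by rewrite !wi; elim/big_ind3: _ => // p1 p2 p3 q1 q2 q3 -> ->.
Qed.

(** On the generalized eigenspace the Poincare map is a shear along the
    periodic trajectories. *)
Lemma poincare_shear (q : 'I_k -> W) (S : 'M[R]_k) :
  (forall a, poincare n A B (q a) =
     q a + \sum_(b < k) S a b *: ((w b 0, w b 1) : W)) ->
  forall t : 'rV[R]_k, let p := \sum_a t 0 a *: q a in
  poincare n A B p = p + (t *m S *m wmx w 0, t *m S *m wmx w 1).
Proof.
move=> Pq t p; rewrite -wmx_pair linear_sum /=.
under eq_bigr do rewrite linearZ /= Pq scalerDr scaler_sumr.
rewrite big_split /= exchange_big /=; congr (_ + _); apply: eq_bigr => b _.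
by rewrite mxE scaler_suml; apply: eq_bigr => a _; rewrite scalerA.
Qed.

Lemma symp_bform p a :
  symp B (w a 0, w a 1) p =
  (bform' B w (flow_seq p) 1 - bform B w (flow_seq p) 0) 0 a.
Proof.
have -> (u v : 'rV[R]_k) : (u - v) 0 a = u 0 a - v 0 a by rewrite !mxE.
by rewrite bform'E bformE subrr add0r.
Qed.

Lemma sympPr p a q r : symp B p (a *: q + r) = a * symp B p q + symp B p r.
Proof.
rewrite /symp /= [pairing (p.1 *m _) _]pairingC pairingPl mulmxDl -scalemxAl.
rewrite pairingPl (pairingC q.2) (pairingC r.2); ring.
Qed.

End Flow.

Unset Implicit Arguments.

Theorem theorem3p2 (R : realType) (m n k : nat) (M : topologicalType)
    (Mstr : manifold R m M) (L : M -> M -> R)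
    (x : int -> M) (phi : int -> chart R m M)
    (n_gt0 : (0 < n)%N)
    (L_C2 : C2_lagrangian Mstr L)
    (x_per : nperiodic n x)
    (phi_atlas : forall i, atlas Mstr (phi i))
    (phi_x : forall i, chart_dom (phi i) (x i))
    (phi_per : nperiodic n phi)
    (x_traj : lagrangian_trajectory L phi x) :
  let A := varA L phi x in
  let B := varB L phi x in
  let P := poincare n A B in
  let V := lker (P - \1)%VF in
  let N := lker (iter (2 * m) (comp_lfun (P - \1)%VF) \1%VF) in
  forall
    (B_nondeg : forall i, B i \in unitmx)
    (V_isotropic : forall p q, p \in V -> q \in V -> symp B p q = 0)
    (dimV : \dim V = k)
    (dimN : \dim N = (2 * k)%N)
    (w : 'I_k -> int -> 'rV[R]_m)
    (w_traj : forall a, var_trajectory A B (w a))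
    (w_per : forall a, nperiodic n (w a))
    (w_basis : basis_of V [seq (w a 0, w a 1) | a <- enum 'I_k])
    (Q : {vspace ('rV[R]_m * 'rV[R]_m)%type})
    (VQ_sum : (V + Q)%VS = N)
    (VQ_cap : (V :&: Q)%VS = 0%VS)
    (q : 'I_k -> 'rV[R]_m * 'rV[R]_m)
    (q_basis : basis_of Q [seq q a | a <- enum 'I_k])
    (wq : forall a b, symp B (w a 0, w a 1) (q b) = (a == b)%:R)
    (qq : forall a b, symp B (q a) (q b) = 0)
    (S : 'M[R]_k)
    (Pq : forall a, P (q a) = q a + \sum_(b < k) S a b *: (w b 0, w b 1))
    (G_nondeg : forall i, Gmx B w i \in unitmx)
    (Gbar_nondeg : Gbar n B w \in unitmx)
    (Aperp_nondeg : Amx_perp n B w S \in unitmx),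
  (neg_index (action_hessian n A B) [set: {ffun 'I_n -> 'rV[R]_m}])%:Z
    - (neg_index (action_hessian n A B) (Zspace n w))%:Z
    - (neg_index (hessian_perp n A B w) (Xperp n B w))%:Z
  = (mx_neg_index (Amx n B w S))%:Z - (mx_neg_index (Amx_perp n B w S))%:Z.

Proof.
move=> A B P V N B_nondeg V_isotropic _ _ w w_traj w_per w_basis Q _ _ q _ wq _.
move=> S Pq G_nondeg Gbar_nondeg Aperp_nondeg.
have A_sym : forall i, (A i)^T = A i := varA_sym L_C2 phi_atlas phi_x.
have B_per : nperiodic n B := varB_periodic L x_per phi_per.
have wV a : (w a 0, w a 1) \in V.
  apply: (basis_mem w_basis).
  by apply: (map_f (fun a => (w a 0, w a 1))); rewrite mem_enum.
have G_sym := Gmx_sym n_gt0 B_per w_per A_sym w_traj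
  (fun a b => V_isotropic _ _ (wV a) (wV b)).
pose p (t : 'rV[R]_k) := \sum_a t 0 a *: q a.
have p_lin a t t' : p (a *: t + t') = a *: p t + p t'.
  rewrite /p scaler_sumr -big_split; apply: eq_bigr => b _ /=.
  by rewrite !mxE scalerA scalerDl.
have flow_n t := flow_seq_pair A B (p t) n.
have flow_0 t := flow_seq_pair A B (p t) 0.
have shear t : (flow_seq A B (p t) n%:Z, flow_seq A B (p t) (n%:Z + 1)) =
    (flow_seq A B (p t) 0 + t *m S *m wmx w 0, flow_seq A B (p t) 1 + t *m S *m wmx w 1).
  by rewrite -flow_n -poincareE (poincare_shear Pq t) {1}[p t]flow_0.
have symp0 a : symp B (w a 0, w a 1) 0 = 0.
  have := sympPr B (w a 0, w a 1) (-1) 0 0.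
  by rewrite scaler0 addr0 mulN1r addNr.
have symp_p t : bform' B w (flow_seq A B (p t)) 1 - bform B w (flow_seq A B (p t)) 0 = t.
  apply/rowP => a; rewrite -symp_bform.
  rewrite /p (big_morph (symp B (w a 0, w a 1)) (id1 := 0) (op1 := +%R)) //; last first.
    by move=> u v; have := sympPr B (w a 0, w a 1) 1 u v; rewrite scale1r mul1r.
  rewrite (bigD1 a) //= big1 => [|b ba]; rewrite -[_ *: _]addr0 sympPr symp0 wq.
    by rewrite eqxx mulr1 !addr0.
  by rewrite eq_sym (negbTE ba) mulr0 addr0.
suff : (neg_index (action_hessian n A B) [set: {ffun 'I_n -> 'rV[R]_m}]
    + mx_neg_index (Amx_perp n B w S) = neg_index (action_hessian n A B) (Zspace n w)
    + neg_index (hessian_perp n A B w) (Xperp n B w) + mx_neg_index (Amx n B w S))%N.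
  by lia.
apply: (index_identity n_gt0 B_per A_sym w_per w_traj G_sym G_nondeg Gbar_nondeg
  (U := fun t => flow_seq A B (p t))) => //.
- by move=> a t t' i; rewrite p_lin flow_seqP.
- by move=> t i /andP[i0 _]; apply: flow_seq_traj.
- by move=> t; case: (shear t).
- by move=> t; case: (shear t).
Qed.
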